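(* For every integer $k\ge 2$, $diss(O_k)=\binom{2k}{k}$, where $O_k=K_{2k+1,k}$ is the odd graph.
   Context: For positive integers $n,k$ with $n\ge 2k$, the Kneser graph $K_{n,k}$ has as vertices all $k$-element subsets of $[n]=\{1,\dots,n\}$, two of them being adjacent if and only if they are disjoint. The odd graph $O_k$ is the Kneser graph $K_{2k+1,k}$. A set $D$ of vertices of a graph $G$ is a dissociation set if the subgraph of $G$ induced by $D$ has maximum degree at most $1$. The dissociation number $diss(G)$ is the maximum cardinality of a dissociation set in $G$. *)

(* Defs.v *)
From mathcomp Require Import all_boot.

Set Implicit Arguments.
Unset Strict Implicit.
Unset Printing Implicit Defensive.

(* A finite simple graph is a symmetric irreflexive [e : rel T] on a finType. *)

Section Graph.
Variables (T : finType) (e : rel T).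

Definition degree (x : T) : nat := #|[set y | e x y]|.

Definition max_degree : nat := \max_(x : T) degree x.

End Graph.

Definition induced (T : finType) (e : rel T) (D : {set T}) :
    rel {x : T | x \in D} :=
  fun x y => e (val x) (val y).

Definition dissociation (T : finType) (e : rel T) (D : {set T}) : bool :=
  max_degree (@induced T e D) <= 1.

Definition diss (T : finType) (e : rel T) : nat :=
  \max_(D : {set T} | dissociation e D) #|D|.

(* 'I_n = {0, ..., n - 1} plays the role of [n] = {1, ..., n}. *)
Definition kneser_vertex (n k : nat) : finType :=
  {A : {set 'I_n} | #|A| == k}.

(* For k = 0 the only vertex is the empty set, which is disjoint from itself;
   this is a simple graph for k > 0 only (see kneser_irr). *)
Definition kneser (n k : nat) : rel (kneser_vertex n k) :=
  fun A B => [disjoint val A & val B].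

Definition odd_graph (k : nat) : rel (kneser_vertex (2 * k + 1) k) :=
  @kneser (2 * k + 1) k.

Lemma kneser_sym n k : symmetric (@kneser n k).
Proof. by move=> A B; rewrite /kneser disjoint_sym. Qed.

Lemma kneser_irr n k : 0 < k -> irreflexive (@kneser n k).
Proof.
move=> k_gt0 A; apply/negbTE; rewrite /kneser -setI_eq0 setIid.
by rewrite -card_gt0 (eqP (valP A)).
Qed.

(* The maximum defining [diss] ranges over a nonempty family. *)
Lemma dissociation0 (T : finType) (e : rel T) : dissociation e set0.
Proof. by apply/bigmax_leqP => -[x x0]; have := x0; rewrite inE. Qed.

(* Main.v *)
Require Import Defs.
From mathcomp Require Import all_boot.
From mathcomp Require Import all_order all_algebra.
From mathcomp Require Import ring lra zify.

(** Write N for the number of vertices of the odd graph, and n = 2k+1.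

    The sets avoiding a fixed point z form a dissociation set of size
    C(2k, k): such a set A is disjoint from exactly one other, namely the
    complement of A together with z.

    The upper bound is Hoffman's ratio bound.  The odd graph is
    (k+1)-regular and its least adjacency eigenvalue is -k.  If D is a
    dissociation set with indicator function d, and c = |D|/N, then
    f = d - c has zero sum, hence <f, Adj f> >= -k <f, f>.  Here
    <f, Adj f> = <d, Adj d> - c (k+1) |D|, where <d, Adj d> <= |D| because
    every vertex of D has at most one neighbour in D, and
    <f, f> = |D| - c |D|.  Rearranging, (2k+1) |D| <= (k+1) N, that is,
    |D| <= C(2k, k).

    For the eigenvalue, note that the k-sets disjoint from a k-set A are the
    sets obtained by removing one point from its complement.  So Adj f is the
    composition of the complement with the up operator U of the Boolean
    lattice, and it suffices to show |U f| <= k |f| for zero-sum f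
    ([complement_form_lb]).  More generally, a zero-sum function f on the
    k-subsets of an n-set satisfies |U f|^2 <= k (n-k-1) |f|^2 ([up_norm]);
    this follows by induction on k from the commutation relation between U
    and its adjoint ([down_up]). *)

Set Implicit Arguments.
Unset Strict Implicit.
Unset Printing Implicit Defensive.

Import Order.TTheory GRing.Theory Num.Theory.

(** * The up and down operators on the Boolean lattice *)

Section BooleanLattice.
Local Open Scope ring_scope.
Variables (R : realFieldType) (T : finType).
Implicit Types (f g : {set T} -> R) (A B : {set T}).

Local Notation n := (#|T|).

Definition up f A : R := \sum_(x in A) f (A :\ x).

Definition down f A : R := \sum_(x | x \notin A) f (x |: A).

Definition dot f g : R := \sum_A f A * g A.

(** Functions on the k-subsets are encoded as functions on all subsets that
    vanish elsewhere, so that the operators need no change of type from one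
    level to the next. *)
Definition at_level k f := forall A, #|A| != k -> f A = 0.

Lemma dotC f g : dot f g = dot g f.
Proof. by apply: eq_bigr => A _; rewrite mulrC. Qed.

Lemma dot_ge0 f : 0 <= dot f f.
Proof. by apply: sumr_ge0 => A _; rewrite -expr2 sqr_ge0. Qed.

Lemma dot_addM (a : R) f g :
  dot (fun A => f A + a * g A) (fun A => f A + a * g A) =
  dot f f + 2 * a * dot f g + a ^+ 2 * dot g g.
Proof.
rewrite /dot !mulr_sumr -!big_split /=; apply: eq_bigr => A _; ring.
Qed.

Lemma up_adjoint f g : dot (up f) g = dot f (down g).
Proof.
rewrite /dot /up /down.
under eq_bigr do rewrite mulr_suml.
under [RHS]eq_bigr do rewrite mulr_sumr.
rewrite (exchange_big_dep predT) //= [RHS](exchange_big_dep predT) //=.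
apply: eq_bigr => x _.
rewrite (reindex_onto (fun B => x |: B) (fun A => A :\ x)) /=; last first.
  by move=> A xA; rewrite setD1K.
apply: eq_big => [B|B /andP[_ /eqP->] //].
rewrite setU11 /=; apply/eqP/idP => [<-|xB]; first by rewrite !inE eqxx.
by rewrite setU1K.
Qed.

(** Both compositions sum f over the sets got from A by exchanging a point of A
    for a point outside; they differ only in how often they return to A
    itself: n - |A| times when adding first, |A| times when removing first. *)
Lemma down_up f A :
  down (up f) A = up (down f) A + (n%:R - 2 * #|A|%:R) * f A.
Proof.
(* The common part: all the genuine exchanges. *)
pose s := \sum_(x | x \notin A) \sum_(y in A) f (x |: (A :\ y)).
have -> : down (up f) A = s + (n%:R - #|A|%:R) * f A.
  rewrite /down /up.
  transitivity (\sum_(x | x \notin A)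
      (\sum_(y in A) f (x |: (A :\ y)) + f A)).
    apply: eq_bigr => x xA; rewrite big_setU1 //= setU1K // addrC.
    congr (_ + _); apply: eq_bigr => y yA; congr (f _).
    apply/setP=> z; rewrite !inE; case: (eqVneq z x) => [->|//].
    by rewrite andbT; apply: contraNneq xA => ->.
  rewrite big_split /= sumr_const -cardsE.
  have -> : [set x | x \notin A] = ~: A by apply/setP=> x; rewrite !inE.
  by rewrite -[_ *+ _]mulr_natl -(cardsC A) natrD [(_ + _ - _)%R]addrC addKr.
have -> : up (down f) A = s + #|A|%:R * f A.
  rewrite /down /up.
  transitivity (\sum_(y in A)
      (\sum_(x | x \notin A) f (x |: (A :\ y)) + f A)).
    apply: eq_bigr => y yA; rewrite (bigD1 y) /=; last by rewrite !inE eqxx.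
    rewrite setD1K // addrC; congr (_ + _); apply: eq_bigl => x.
    rewrite !inE; case: (eqVneq x y) => [->|_]; rewrite ?yA ?andbT //.
  by rewrite big_split /= exchange_big sumr_const -[_ *+ _]mulr_natl.
ring.
Qed.

Lemma sum_up f : \sum_A up f A = \sum_A f A * (n%:R - #|A|%:R).
Proof.
transitivity (dot (up f) (fun=> 1)).
  by apply: eq_bigr => A _; rewrite mulr1.
rewrite up_adjoint; apply: eq_bigr => A _; congr (_ * _).
rewrite /down sumr_const -cardsE.
have -> : [set x | x \notin A] = ~: A by apply/setP=> x; rewrite !inE.
by rewrite -(cardsC A) natrD [(_ + _ - _)%R]addrC addKr.
Qed.

Lemma sum_down f : \sum_A down f A = \sum_A f A * #|A|%:R.
Proof.
transitivity (dot (up (fun=> 1)) f).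
  by rewrite up_adjoint; apply: eq_bigr => A _; rewrite mul1r.
by apply: eq_bigr => A _; rewrite mulrC /up sumr_const.
Qed.

Lemma level_up k f : at_level k f -> at_level k.+1 (up f).
Proof.
move=> fk A Ak; apply: big1 => x xA; apply: fk.
by apply: contraNneq Ak => <-; rewrite (cardsD1 x A) xA.
Qed.

Lemma level_down k f : at_level k.+1 f -> at_level k (down f).
Proof.
move=> fk A Ak; apply: big1 => x xA; apply: fk.
by rewrite cardsU1 xA add1n eqSS.
Qed.

Lemma level0_eq0 f A : at_level 0 f -> \sum_B f B = 0 -> f A = 0.
Proof.
move=> f0; rewrite (bigD1 set0) //= big1 ?addr0 => [fE|B B0]; last first.
  by apply: f0; rewrite cards_eq0.
by case: (eqVneq A set0) => [-> //|A0]; apply: f0; rewrite cards_eq0.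
Qed.

(** With l = k (n-k-1) the constant at level k and g = down f, for f at level
    k+1, the relation [down_up] gives |up f|^2 = |g|^2 + (n - 2(k+1)) |f|^2.
    The bound |up h|^2 <= l |h|^2 for zero-sum h at level k passes to the
    adjoint as |g|^2 <= l |f|^2, and l + n - 2(k+1) is the constant
    at level k+1. *)
Lemma up_norm k f : (k < n)%N -> at_level k f -> \sum_A f A = 0 ->
  dot (up f) (up f) <= k%:R * (n%:R - k%:R - 1) * dot f f.
Proof.
elim: k f => [|k IHk] f kn fk f0.
  rewrite !mul0r /dot big1 // => A _.
  by rewrite /up big1 ?mul0r // => x _; apply: level0_eq0.
pose g := down f; pose l : R := k%:R * (n%:R - k%:R - 1).
have gk : at_level k g by apply: level_down.
have g0 : \sum_A g A = 0.
  rewrite sum_down (eq_bigr (fun A => f A * k.+1%:R)) => [|A _].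
    by rewrite -mulr_suml f0 mul0r.
  by case: (eqVneq #|A| k.+1) => [-> //|/fk ->]; rewrite !mul0r.
have upE : dot (up f) (up f) = dot g g + (n%:R - 2 * k.+1%:R) * dot f f.
  rewrite up_adjoint -[dot g g](up_adjoint g f) [dot (up g) f]dotC /dot.
  rewrite mulr_sumr -big_split /=; apply: eq_bigr => A _; rewrite down_up.
  by case: (eqVneq #|A| k.+1) => [->|/fk ->]; ring.
have gg : dot g g <= l * dot f f.
  case: k IHk @l fk gk {upE} kn => [|k] IHk l fk gk kn.
    rewrite /l !mul0r /dot big1 // => A _.
    by rewrite (level0_eq0 A gk g0) mul0r.
  have l_gt0 : 0 < l.
    by rewrite mulr_gt0 ?ltr0n // -addrA -opprD subr_gt0 -natr1 natr1 natr1 ltr_nat.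
  have := IHk g (ltnW kn) gk g0; rewrite -/l => upg.
  (* The adjoint bound without square roots: expand |up g - l f|^2 >= 0,
     where <up g, f> = |g|^2. *)
  have := dot_ge0 (fun A => up g A + - l * f A).
  have fg : dot (up g) f = dot g g by rewrite up_adjoint.
  rewrite dot_addM fg => pos.
  have : 0 <= l * (l * dot f f - dot g g) by nra.
  by rewrite pmulr_rge0 // subr_ge0.
rewrite upE -!natr1; move: gg; rewrite /l; move: (dot g g) (dot f f) => a b.
lra.
Qed.

(** The left summand is <f, Adj f> for the adjacency operator Adj of the odd
    graph.  By [up_norm] with n = 2k+1, Adj has norm at most k on zero-sum
    functions, so expanding |Adj f + k f|^2 >= 0 shows that its spectrum there
    is bounded below by -k. *)
Lemma complement_form_lb k f : n = (2 * k + 1)%N -> (0 < k)%N ->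
  at_level k f -> \sum_A f A = 0 ->
  0 <= \sum_A f A * up f (~: A) + k%:R * dot f f.
Proof.
move=> nE k_gt0 fk f0; pose h A := up f (~: A).
have hh : dot h h <= k%:R * k%:R * dot f f.
  have -> : dot h h = dot (up f) (up f).
    by rewrite [RHS](reindex_inj (@setC_inj T)).
  have -> : k%:R * k%:R = k%:R * (n%:R - k%:R - 1) :> R.
    by rewrite nE natrD natrM; ring.
  by apply: up_norm => //; rewrite nE; lia.
have := dot_ge0 (fun A => h A + k%:R * f A).
rewrite dot_addM dotC -/(dot f h) => pos.
have k_pos : 0 < k%:R :> R by rewrite ltr0n.
have : 0 <= k%:R * (dot f h + k%:R * dot f f) by nra.
by rewrite pmulr_rge0.
Qed.

End BooleanLattice.

(** * The ratio bound for dissociation sets *)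

Section Bound.
Local Open Scope ring_scope.

(** The ratio bound, applied to the indicator function d of D made
    orthogonal to the constants.  Neighbours of A are written as complements
    of A with a point removed, to match the up operator. *)
Lemma sparse_family_bound (T : finType) (k : nat) (D : {set {set T}}) :
    #|T| = (2 * k + 1)%N -> (0 < k)%N ->
    (forall A, A \in D -> #|A| = k) ->
    (forall A, A \in D -> (#|[set x in ~: A | ~: A :\ x \in D]| <= 1)%N) ->
  (#|D| <= 'C(2 * k, k))%N.
Proof.
move=> nE k_gt0 Dk Dsparse.
pose N := 'C(2 * k + 1, k).
have N_gt0 : (0 < N)%N by rewrite bin_gt0; lia.
have NE : ((k + 1) * N = (2 * k + 1) * 'C(2 * k, k))%N.
  have := mul_bin_down (2 * k + 1) k; rewrite -/N addn1 /= => ->.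
  by congr (_ * _)%N; lia.
pose lvl (A : {set T}) : rat := (#|A| == k)%:R.
have sum_lvl : \sum_A lvl A = N%:R.
  by rewrite /lvl -natr_sum -big_mkcond sum1dep_card card_draws nE.
pose c : rat := #|D|%:R / N%:R.
have cN : c * N%:R = #|D|%:R by rewrite divfK // pnatr_eq0 -lt0n.
pose d (A : {set T}) : rat := (A \in D)%:R.
have sum_d : \sum_A d A = #|D|%:R.
  by rewrite /d -natr_sum -big_mkcond sum1_card.
have d_lvl A : lvl A * d A = d A.
  by rewrite /lvl /d; case AD: (A \in D); rewrite ?mulr0 // Dk // eqxx mul1r.
have dk : at_level k d.
  by move=> A Ak; rewrite -d_lvl /lvl (negbTE Ak) mul0r.
pose f (A : {set T}) : rat := d A - c * lvl A.
have fk : at_level k f.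
  by move=> A Ak; rewrite /f dk // /lvl (negbTE Ak) mulr0 subr0.
have sum_f : \sum_A f A = 0.
  by rewrite /f big_split /= sumrN -mulr_sumr sum_d sum_lvl cN subrr.
have f_lvl A : f A * lvl A = f A.
  by rewrite /lvl; case: eqVneq => [_|/fk ->]; rewrite ?mulr1 ?mul0r.
(* Only one factor needs expanding, f being orthogonal to the constants. *)
have ff : dot f f = #|D|%:R - c * #|D|%:R.
  rewrite -sum_d mulr_sumr -sumrB /dot.
  transitivity (\sum_A (d A - c * d A - c * f A)).
    apply: eq_bigr => A _; rewrite {2}/f mulrBr mulrCA f_lvl.
    congr (_ - _); rewrite /f mulrBl -mulrA d_lvl.
    by congr (_ - _); rewrite /d -natrM mulnb andbb.
  by rewrite [LHS]sumrB -[\sum_A c * f A]mulr_sumr sum_f mulr0 subr0.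
have sum_up_d : \sum_A lvl A * up d (~: A) = (k + 1)%:R * #|D|%:R.
  transitivity (\sum_A up d A).
    rewrite [RHS](reindex_inj (@setC_inj T)); apply: eq_bigr => A _; rewrite /lvl.
    case: eqVneq => [_|Ak]; rewrite ?mul1r ?mul0r // (level_up dk) //.
    by apply: contra Ak => /eqP; have := cardsC A; rewrite nE; lia.
  rewrite sum_up -sum_d mulr_sumr; apply: eq_bigr => A _.
  case: (eqVneq #|A| k) => [->|/dk ->]; last by rewrite mul0r mulr0.
  by rewrite mulrC nE -natrB; [congr (_%:R * _); lia | lia].
have fAf : \sum_A f A * up f (~: A) =
    \sum_A d A * up d (~: A) - c * ((k + 1)%:R * #|D|%:R).
  rewrite -sum_up_d mulr_sumr -sumrB.
  transitivity (\sum_A ((d A * up d (~: A) - c * (lvl A * up d (~: A)))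
                        - (c * (k + 1)%:R) * f A)).
    apply: eq_bigr => A _.
    have [Ak|Ak] := eqVneq #|A| k; last first.
      by rewrite fk // dk // /lvl (negbTE Ak) !mul0r !mulr0 !subr0.
    have -> : up f (~: A) = up d (~: A) - c * (k + 1)%:R.
      have -> : (k + 1)%:R = \sum_(x in ~: A) 1 :> rat.
        rewrite sumr_const; congr (_%:R).
        by have := cardsC A; rewrite nE; lia.
      rewrite /up mulr_sumr -sumrB; apply: eq_bigr => x xA.
      rewrite /f /lvl (_ : _ == k) //.
      by have := cardsC A; rewrite nE (cardsD1 x (~: A)) xA; lia.
    by rewrite /f; ring.
  by rewrite [LHS]sumrB -[\sum_A _ * f A]mulr_sumr sum_f mulr0 subr0.
have dAd : \sum_A d A * up d (~: A) <= #|D|%:R.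
  rewrite -sum_d; apply: ler_sum => A _.
  rewrite /d; case AD: (A \in D); last by rewrite mul0r.
  rewrite mul1r /up -natr_sum ler_nat.
  apply: leq_trans (Dsparse A AD); rewrite -sum1dep_card.
  by rewrite [leqRHS]big_mkcondr.
have := complement_form_lb nE k_gt0 fk sum_f; rewrite fAf ff => pos.
(* With dAd, pos becomes 0 <= |D| (k+1 - c (2k+1)); dividing by |D| bounds c. *)
have [->|D_gt0] := posnP #|D|; first by [].
have D_pos : 0 < #|D|%:R :> rat by rewrite ltr0n.
have c_le : c * (2 * k + 1)%:R <= (k + 1)%:R.
  have -> : (2 * k + 1)%:R = 2 * k%:R + 1 :> rat by rewrite natrD natrM.
  move: pos dAd D_pos; rewrite natrD; move: #|D|%:R => m.
  move: (\sum_A _) => s pos sm m_gt0.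
  have : 0 <= m * (k%:R + 1 - c * (2 * k%:R + 1)) by nra.
  by rewrite pmulr_rge0 // subr_ge0.
have : (#|D| * (2 * k + 1) <= (k + 1) * N)%N.
  rewrite -(ler_nat rat) !natrM -cN mulrAC ler_wpM2r //.
by rewrite NE mulnC leq_pmul2l ?addn1.
Qed.

End Bound.

(** Removing distinct points from the complement of B gives distinct sets
    disjoint from B, so the points counted in the sparsity hypothesis inject
    into the neighbours of B inside D. *)
Lemma odd_graph_dissociation_bound k (D : {set kneser_vertex (2 * k + 1) k}) :
  0 < k -> dissociation (@odd_graph k) D -> #|D| <= 'C(2 * k, k).
Proof.
move=> k_gt0 /bigmax_leqP dissD.
have valE (B : kneser_vertex (2 * k + 1) k) : #|val B| = k.
  exact/eqP/(valP B).
rewrite -(card_imset _ val_inj).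
apply: sparse_family_bound => //; first by rewrite card_ord.
  by move=> _ /imsetP[B _ ->].
move=> _ /imsetP[B BD ->].
apply: leq_trans (dissD (Sub B BD) isT); rewrite /degree.
rewrite -(card_imset _ (inj_comp val_inj val_inj)).
pose h x := ~: val B :\ x.
rewrite -(@card_in_imset _ _ h); last first.
  move=> x y; rewrite !inE => /andP[xB _] /andP[yB _] /setP /(_ x).
  by rewrite /h !inE eqxx xB /=; case: eqVneq.
apply/subset_leq_card/subsetP => _ /imsetP[x + ->].
rewrite inE => /andP[xB /imsetP[C CD CE]].
apply/imsetP; exists (Sub C CD) => //.
rewrite inE /induced /odd_graph /kneser /= -CE.
by rewrite disjoint_sym disjoints_subset subsetDl.
Qed.

(** * An extremal dissociation set *)

Definition avoiding n k (z : 'I_n) : {set kneser_vertex n k} :=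
  [set A : kneser_vertex n k | z \notin val A].

(** A neighbour of A avoiding z lies in the complement of z |: A, which has
    only k elements, so it is that complement. *)
Lemma avoiding_dissociation k (z : 'I_(2 * k + 1)) :
  dissociation (@odd_graph k) (avoiding k z).
Proof.
apply/bigmax_leqP => -[A zA] _.
have complE (B : {x | x \in avoiding k z}) : odd_graph A (val B) ->
    val (val B) = ~: (z |: val A).
  case: B => B zB /= AB; rewrite !inE in zA zB.
  apply/eqP; rewrite eqEcard; apply/andP; split.
    rewrite setCU subsetI subsetC sub1set inE zB -disjoints_subset.
    by rewrite disjoint_sym.
  have : #|~: (z |: val A)| = k.
    have := cardsC (z |: val A).
    by rewrite cardsU1 zA card_ord (eqP (valP A)); lia.
  by rewrite (eqP (valP B)) => /eq_leq.
apply/card_le1_eqP => B C; rewrite !inE => AB AC.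
by apply/val_inj/val_inj; rewrite !complE.
Qed.

Lemma card_avoiding n k (z : 'I_n) : #|avoiding k z| = 'C(n.-1, k).
Proof.
have <- : #|~: [set z]| = n.-1 by rewrite cardsC1 card_ord.
rewrite -cards_draws -(card_imset _ val_inj).
apply: eq_card => A; rewrite inE subsetC sub1set inE.
apply/imsetP/andP => [[B zB ->]|[zA Ak]].
  by rewrite inE in zB; rewrite zB (valP B).
by exists (Sub A Ak); rewrite ?inE.
Qed.

Theorem theorem4p2 (k : nat) (k_ge2 : 2 <= k) :
  diss (@odd_graph k) = 'C(2 * k, k).
Proof.
apply/eqP; rewrite eqn_leq; apply/andP; split.
  apply/bigmax_leqP => D; apply: odd_graph_dissociation_bound.
  exact: ltnW.
have z : 'I_(2 * k + 1) by rewrite addn1; exact: ord0.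
have -> : 'C(2 * k, k) = #|avoiding k z| by rewrite card_avoiding addn1.
exact/leq_bigmax_cond/avoiding_dissociation.
Qed.
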